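(* Let $X$ be an affine toric variety with acting torus $T$ over $\mathbb{K}$ and $x\in X$. Then $G(T\cdot x)=\Gamma(T\cdot x)$, i.e. the subgroup of $\mathrm{Cl}(X)$ generated by the classes of the prime $T$-invariant divisors not containing the orbit $T\cdot x$ coincides with the semigroup generated by the same classes.
   Context: The ground field $\mathbb{K}$ is algebraically closed of characteristic zero. A toric variety is a normal algebraic variety $X$ containing an algebraic torus $T$ as a dense open subset such that the action of $T$ on itself extends to a regular action of $T$ on $X$. $\mathrm{Cl}(X)$ is the divisor class group of $X$. Let $D_1,\dots,D_m$ be the prime $T$-invariant divisors on $X$. For a $T$-orbit $\mathcal{O}\subseteq X$ let $D(\mathcal{O})$ be the set of those $D_i$ that do not contain $\mathcal{O}$. $G(\mathcal{O})$ is the subgroup of $\mathrm{Cl}(X)$ generated by the classes of the divisors in $D(\mathcal{O})$, and $\Gamma(\mathcal{O})$ is the semigroup in $\mathrm{Cl}(X)$ generated by the classes of the divisors in $D(\mathcal{O})$. Semigroups are understood to contain $0$ (so the semigroup generated by the empty set is $\{0\}$). *)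

(* Defs.v *)
From HB Require Import structures.
From mathcomp Require Import all_boot all_order all_algebra.
From mathcomp Require Import mathcomp_extra boolp classical_sets.
From mathcomp Require Import generic_quotient ring_quotient fraction.
From mathcomp Require Import mpoly freeg.

Set Implicit Arguments.
Unset Strict Implicit.
Unset Printing Implicit Defensive.

Import GRing.Theory.
Local Open Scope classical_set_scope.
Local Open Scope ring_scope.
Local Open Scope quotient_scope.

Section AffineSpace.
Variable K : closedFieldType.

Definition zariski_closed n (Z : set 'rV[K]_n) : Prop :=
  exists S : set {mpoly K[n]},
    Z = [set x | forall p, S p -> p.@[x 0] = 0].

Definition zariski_irreducible n (Z : set 'rV[K]_n) : Prop :=
  Z !=set0 /\
  forall Z1 Z2, zariski_closed Z1 -> zariski_closed Z2 ->
    Z `<=` Z1 `|` Z2 -> Z `<=` Z1 \/ Z `<=` Z2.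

(* Morphisms between closed subsets of affine spaces are the restrictions of
   polynomial maps.  Values of [f] outside [Z] are irrelevant. *)
Definition polynomial_map m n (Z : set 'rV[K]_m) (f : 'rV[K]_m -> 'rV[K]_n) :
    Prop :=
  exists P : 'I_n -> {mpoly K[m]},
    forall z, Z z -> forall j, f z 0 j = (P j).@[z 0].

(* Regular functions on a locally closed subset [U]: near every point of [U]
   the function is a quotient of polynomials.  The neighbourhood is the
   principal open subset of [U] on which the denominator does not vanish; any
   neighbourhood can be shrunk to one of this form by multiplying [p] and [q]
   by a common polynomial. *)
Definition regular_on n (U : set 'rV[K]_n) (phi : 'rV[K]_n -> K) : Prop :=
  forall x, U x -> exists p q : {mpoly K[n]},
    q.@[x 0] != 0 /\
    forall y, U y -> q.@[y 0] != 0 -> phi y = p.@[y 0] / q.@[y 0].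

Record affineVariety n := AffineVariety {
  points :> set 'rV[K]_n;
  points_closed : zariski_closed points;
  points_irreducible : zariski_irreducible points }.

End AffineSpace.

Section CoordinateRing.
Variables (K : closedFieldType) (n : nat) (X : affineVariety K n).

Definition vanishing_ideal : {pred {mpoly K[n]}} :=
  fun p => `[< forall x, points X x -> p.@[x 0] = 0 >].

Lemma vanishing_idealP p :
  reflect (forall x, points X x -> p.@[x 0] = 0) (p \in vanishing_ideal).
Proof. exact: asboolP. Qed.

Lemma vanishing_ideal_closed : idealr_closed vanishing_ideal.
Proof.
split.
- by apply/vanishing_idealP => x _; rewrite meval0.
- apply/negP => /vanishing_idealP I1.
  have [[x Xx] _] := points_irreducible X.
  by have /eqP := I1 x Xx; rewrite meval1 oner_eq0.
- move=> a u v /vanishing_idealP Iu /vanishing_idealP Iv.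
  by apply/vanishing_idealP => x Xx; rewrite mevalD mevalM Iu ?Iv ?mulr0 ?addr0.
Qed.

HB.instance Definition _ :=
  isIdealr.Build {mpoly K[n]} vanishing_ideal vanishing_ideal_closed.

Lemma vanishing_ideal_prime : prime_idealr_closed vanishing_ideal.
Proof.
move=> u v /vanishing_idealP Iuv; have [_ irrX] := points_irreducible X.
have zeros_closed p : zariski_closed [set x : 'rV[K]_n | p.@[x 0] = 0].
  by exists [set p]; apply/seteqP; split => [x px q -> //|x /(_ p erefl)].
have [x Xx|Zu|Zv] := irrX _ _ (zeros_closed u) (zeros_closed v).
- by have /eqP := Iuv x Xx; rewrite mevalM mulf_eq0 => /orP[] /eqP; [left|right].
- by apply/orP; left; apply/vanishing_idealP => x /Zu.
- by apply/orP; right; apply/vanishing_idealP => x /Zv.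
Qed.

HB.instance Definition _ :=
  isPrimeIdealrClosed.Build {mpoly K[n]} vanishing_ideal vanishing_ideal_prime.

Definition coordRing : Type := {ideal_quot vanishing_ideal}.

HB.instance Definition _ := GRing.ComNzRing.on coordRing.

Definition coord_unit : {pred coordRing} := fun a => `[< exists b, b * a = 1 >].

Definition coord_inv (a : coordRing) : coordRing :=
  xget a [set b | b * a = 1].

Lemma coord_mulVx : {in coord_unit, left_inverse 1 coord_inv *%R}.
Proof.
move=> a /asboolP[b ba1]; rewrite /coord_inv.
by case: xgetP => [c _ //|/(_ b)].
Qed.

Lemma coord_unitPl (a b : coordRing) : b * a = 1 -> coord_unit a.
Proof. by move=> ba1; apply/asboolP; exists b. Qed.

Lemma coord_invr_out : {in [predC coord_unit], coord_inv =1 id}.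
Proof.
move=> a /asboolPn Ua; rewrite /coord_inv.
by case: xgetP => [c _ ca1|//]; case: Ua; exists c.
Qed.

HB.instance Definition _ := GRing.ComNzRing_hasMulInverse.Build coordRing
  coord_mulVx coord_unitPl coord_invr_out.

Lemma coord_integral : GRing.integral_domain_axiom coordRing.
Proof. by move=> a b; exact: Quotient.rquot_IdomainAxiom. Qed.

HB.instance Definition _ :=
  GRing.ComUnitRing_isIntegral.Build coordRing coord_integral.

(* Meaningful only for [x] in [X], where it does not depend on the chosen
   representative. *)
Definition coord_eval (a : coordRing) (x : 'rV[K]_n) : K := (repr a).@[x 0].

Definition functionField : fieldType := {fraction coordRing}.

Definition to_functionField (a : coordRing) : functionField := tofrac a.

Definition normal_variety : Prop :=
  forall z : functionField, integralOver to_functionField z ->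
    exists a, z = to_functionField a.

End CoordinateRing.

Section ClassGroup.
Variables (K : closedFieldType) (n : nat) (X : affineVariety K n).

Record primeDivisor := PrimeDivisor {
  divisor_points :> set 'rV[K]_n;
  divisor_closed : zariski_closed divisor_points;
  divisor_irreducible : zariski_irreducible divisor_points;
  divisor_proper : divisor_points `<` X;
  divisor_codim1 : forall Z, zariski_closed Z -> zariski_irreducible Z ->
    divisor_points `<` Z -> Z `<=` X -> Z = X }.

HB.instance Definition _ := gen_eqMixin primeDivisor.
HB.instance Definition _ := gen_choiceMixin primeDivisor.

Definition divisor_ideal (D : primeDivisor) : set (coordRing X) :=
  [set a | forall x, divisor_points D x -> coord_eval a x = 0].

(* Finite sums of multiples of [k]-fold products; the coefficients [t.1] make
   the power [0] the whole ring. *)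
Definition ideal_power (R : comNzRingType) (I : set R) (k : nat) : set R :=
  [set a | exists s : seq (R * k.-tuple R),
     (forall t, t \in s -> forall i, I (tnth t.2 i)) /\
     a = \sum_(t <- s) t.1 * \prod_(i < k) tnth t.2 i].

(* The [k]-th power of the maximal ideal of the local ring of [X] at [D], as a
   subset of the function field; the local ring itself for [k = 0]. *)
Definition local_power (D : primeDivisor) (k : nat) : set (functionField X) :=
  [set z | exists a s : coordRing X,
     [/\ ideal_power (divisor_ideal D) k a, ~ divisor_ideal D s
       & z = to_functionField a / to_functionField s]].

(* On the local ring, the valuation of a nonzero element is the largest [k]
   such that the element lies in the [k]-th power of the maximal ideal (for
   normal [X] the local ring is a discrete valuation ring); it is extended to
   the function field by [v (a / b) = v a - v b]. *)
Definition has_local_order (D : primeDivisor) (z : functionField X) (k : nat) :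
    Prop :=
  local_power D k z /\ ~ local_power D k.+1 z.

Definition has_order (D : primeDivisor) (z : functionField X) (k : int) : Prop :=
  exists a b : coordRing X, exists i j : nat,
    [/\ b != 0, z = to_functionField a / to_functionField b,
        has_local_order D (to_functionField a) i,
        has_local_order D (to_functionField b) j
      & k = i%:Z - j%:Z].

Definition weilDivisor : zmodType := {freeg primeDivisor / int}.

Definition principal : set weilDivisor :=
  [set E | exists2 z : functionField X,
     z != 0 & forall D, has_order D z (coeff D E)].

End ClassGroup.

Section Generated.
Variable V : zmodType.

Definition subgroup_generated (S : set V) : set V :=
  smallest (fun A : set V => zmod_closed [pred x in A]) S.

(* Semigroups contain [0]. *)
Definition semigroup_generated (S : set V) : set V :=
  smallest (fun A : set V => Algebra.nmod_closed [pred x in A]) S.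

End Generated.

Section ClassGroupQuotient.
Variables (K : closedFieldType) (n : nat) (X : affineVariety K n).

(* On a normal variety [principal] is already a subgroup, so that generating
   one adds nothing; it only spares proving this fact here. *)
Definition principal_subgroup : {pred weilDivisor X} :=
  fun E => `[< subgroup_generated (@principal K n X) E >].

Lemma principal_subgroup_closed : zmod_closed principal_subgroup.
Proof.
split=> [|x y].
  by apply/asboolP => A [[A0 _] _]; exact: set_mem A0.
move=> /asboolP Px /asboolP Py; apply/asboolP => A AP.
have [[_ AB] _] := AP.
by apply: set_mem; apply: AB; apply: mem_set; [exact: Px|exact: Py].
Qed.

HB.instance Definition _ := GRing.isZmodClosed.Build (weilDivisor X)
  principal_subgroup principal_subgroup_closed.

Definition classGroup : zmodType := Quotient.quot principal_subgroup.

Definition divisor_class (D : primeDivisor X) : classGroup :=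
  \pi_(Quotient.quot principal_subgroup) (<< D >> : weilDivisor X).

End ClassGroupQuotient.

Section Toric.
Variable K : closedFieldType.

(* The d-dimensional torus, as the closed subset of K^d x K^d of pairs (t, s)
   with t_i s_i = 1 for all i; the group law is coordinatewise
   multiplication. *)
Definition torus d : set 'rV[K]_(d + d) :=
  [set t | forall i : 'I_d, t 0 (lshift d i) * t 0 (rshift d i) = 1].

Arguments torus d : clear implicits.

Definition torus_mul d (s t : 'rV[K]_(d + d)) : 'rV[K]_(d + d) :=
  map2_mx *%R s t.

Definition torus_one d : 'rV[K]_(d + d) := const_mx 1.

Arguments torus_one d : clear implicits.

(* Only the values of [torus_embed] on the torus, and of [torus_act] on the
   product of the torus with [X], are relevant. *)
Record toricStructure n (X : affineVariety K n) (d : nat) := ToricStructure {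
  toric_normal : normal_variety X;
  torus_embed : 'rV[K]_(d + d) -> 'rV[K]_n;
  torus_act : 'rV[K]_(d + d) -> 'rV[K]_n -> 'rV[K]_n;
  torus_embed_in : forall t, torus d t -> points X (torus_embed t);
  torus_embed_polynomial : polynomial_map (torus d) torus_embed;
  torus_embed_iso : exists g : 'rV[K]_n -> 'rV[K]_(d + d),
    (forall t, torus d t -> g (torus_embed t) = t) /\
    (forall i, regular_on (torus_embed @` torus d) (fun x => g x 0 i));
  torus_embed_open : exists2 Z, zariski_closed Z &
    torus_embed @` torus d = X `\` Z;
  torus_embed_dense : forall Z, zariski_closed Z ->
    torus_embed @` torus d `<=` Z -> X `<=` Z;
  torus_act_in : forall t x, torus d t -> points X x ->
    points X (torus_act t x);
  torus_act_polynomial :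
    polynomial_map [set z | torus d (lsubmx z) /\ points X (rsubmx z)]
      (fun z => torus_act (lsubmx z) (rsubmx z));
  torus_act1 : forall x, points X x -> torus_act (torus_one d) x = x;
  torus_actM : forall s t x, torus d s -> torus d t -> points X x ->
    torus_act (torus_mul s t) x = torus_act s (torus_act t x);
  torus_act_embed : forall s t, torus d s -> torus d t ->
    torus_act s (torus_embed t) = torus_embed (torus_mul s t) }.

Variables (n : nat) (X : affineVariety K n) (d : nat) (T : toricStructure X d).

Definition torus_orbit (x : 'rV[K]_n) : set 'rV[K]_n :=
  [set torus_act T t x | t in torus d].

Definition torus_invariant (D : primeDivisor X) : Prop :=
  forall t x, torus d t -> divisor_points D x ->
    divisor_points D (torus_act T t x).

Definition divisors_off (O : set 'rV[K]_n) : set (primeDivisor X) :=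
  [set D | torus_invariant D /\ ~ (O `<=` D)].

Definition orbit_group (O : set 'rV[K]_n) : set (classGroup X) :=
  subgroup_generated (@divisor_class K n X @` divisors_off O).

Definition orbit_semigroup (O : set 'rV[K]_n) : set (classGroup X) :=
  semigroup_generated (@divisor_class K n X @` divisors_off O).

End Toric.

(* Main.v *)
Require Import Defs.
From HB Require Import structures.
From mathcomp Require Import all_boot all_order all_algebra.
From mathcomp Require Import boolp classical_sets.
From mathcomp Require Import generic_quotient ring_quotient fraction.
From mathcomp Require Import mpoly freeg.

Set Implicit Arguments.
Unset Strict Implicit.
Unset Printing Implicit Defensive.

Import Order.TTheory GRing.Theory.
Local Open Scope classical_set_scope.
Local Open Scope ring_scope.
Local Open Scope quotient_scope.

(* It suffices to show that -[D0] lies in the semigroup for each invariant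
   prime divisor D0 missing x.  Since X is affine, some regular function
   vanishes on D0 but not at x; decomposing its translates into characters of T
   gives a semi-invariant f with the same property.  The components of the zero
   locus of f are T-stable and miss x, and there are finitely many of them, so
   0 = [div f] = sum_i v_i [D_i], where all D_i belong to D(T.x), all v_i are
   positive and D0 is one of the D_i.  Hence -[D0] is a nonnegative
   combination of the [D_i].

   Only the existence of the order of f along D, as the largest k with f in the
   k-th power of the maximal ideal, is required: it is Krull's intersection
   theorem. *)

(** * Dickson's lemma and Noetherian rings *)

(** Each new index minimizes [a] on the tail after the previous index, so its value bounds all later
    ones from below. *)
Lemma nondecreasing_subsequence (a : nat -> nat) :
  exists phi : nat -> nat, {homo phi : i j / (i < j)%N} /\
    {homo a \o phi : i j / (i <= j)%N}.
Proof.
have tail_min p : exists j, (p <= j)%N /\ forall k, (p <= k)%N -> (a j <= a k)%N.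
  have /ex_minnP[v /asboolP[j pj <-] minv] :
      exists v, `[< exists2 j, (p <= j)%N & a j = v >].
    by exists (a p); apply/asboolP; exists p.
  by exists j; split=> // k pk; apply: minv; apply/asboolP; exists k.
have [nxt nxtP] := choice tail_min.
pose phi := fix phi k := if k is k'.+1 then nxt (phi k').+1 else nxt 0%N.
have phi_min k l : (phi k <= l)%N -> (a (phi k) <= a l)%N.
  move=> le_l; case: k le_l => [|k] le_l; first exact: (nxtP 0%N).2.
  apply: (nxtP _).2; apply: leq_trans le_l; exact: (nxtP _).1.
have phiS k : (phi k < phi k.+1)%N by exact: (nxtP _).1.
have phi_lt : {homo phi : i j / (i < j)%N} by exact: homo_ltn ltn_trans phiS.
exists phi; split=> //.
apply: homo_leq leqnn leq_trans _ => k /=; exact/phi_min/ltnW/phiS.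
Qed.

(** Pass to subsequences one coordinate at a time: after [l] rounds the first [l] exponents are
    nondecreasing along [phi]. *)
Lemma dickson n (m : nat -> 'X_{1..n}) :
  exists i j, (i < j)%N /\ (m i <= m j)%MM.
Proof.
have /(_ n)[phi [phi_lt mono]] : forall l, exists phi : nat -> nat,
    {homo phi : i j / (i < j)%N} /\
    forall k : 'I_n, (k < l)%N -> {homo (fun i => m (phi i) k) : i j / (i <= j)%N}.
  elim=> [|l [phi [phi_lt mono]]]; first by exists id; split.
  case: (ltnP l n) => [ltln|lenl]; last first.
    exists phi; split=> // k _; apply: mono; exact: leq_trans (ltn_ord k) lenl.
  have [psi [psi_lt psi_mono]] :=
    nondecreasing_subsequence (fun i => m (phi i) (Ordinal ltln)).
  exists (phi \o psi); split=> [i j ij|k] /=; first exact/phi_lt/psi_lt.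
  rewrite ltnS leq_eqVlt => /orP[/eqP kl|ltkl] i j ij /=.
    by rewrite (_ : k = Ordinal ltln); [exact: psi_mono|exact: val_inj].
  apply: mono => //; move: ij; rewrite leq_eqVlt => /orP[/eqP->//|ij].
  exact/ltnW/psi_lt.
exists (phi 0%N), (phi 1%N); split; first exact: phi_lt.
by apply/mnm_lepP => k; apply: (mono k (ltn_ord k) 0%N 1%N).
Qed.

Section Noetherian.
Variable R : comNzRingType.

Definition in_span (u : nat -> R) (N : nat) (x : R) : Prop :=
  exists c : nat -> R, x = \sum_(i < N) c i * u i.

(** The ascending chain condition, phrased for the ideals generated by initial segments of a
    sequence. *)
Definition noetherian : Prop := forall u : nat -> R, exists N, in_span u N (u N).

Lemma in_span_comb u N a x y :
  in_span u N x -> in_span u N y -> in_span u N (a * x + y).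
Proof.
move=> [c ->] [e ->]; exists (fun i => a * c i + e i).
rewrite mulr_sumr -big_split; apply: eq_bigr => i _ /=.
by rewrite mulrDl mulrA.
Qed.

Lemma in_span_le u M N x : (M <= N)%N -> in_span u M x -> in_span u N x.
Proof.
move=> leMN [c ->]; exists (fun i => if (i < M)%N then c i else 0).
rewrite (big_ord_widen N (fun i => c i * u i) leMN) big_mkcond.
by apply: eq_bigr => i _; case: ifP; rewrite ?mul0r.
Qed.

Lemma in_span_gen u i N : (i < N)%N -> in_span u N (u i).
Proof.
move=> ltiN; exists (fun j => (j == i)%:R).
rewrite (bigD1 (Ordinal ltiN)) //= eqxx mul1r big1 ?addr0 // => j.
by rewrite -val_eqE /= => /negPf ->; rewrite mul0r.
Qed.

(** Otherwise every finite list in [S] extends by an element of [S] outside its span, and the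
    resulting sequence contradicts [noetherian]. *)
Lemma noetherian_fg (S : set R) : noetherian ->
  exists r (a : nat -> R),
    (forall i, (i < r)%N -> S (a i)) /\ (forall x, S x -> in_span a r x).
Proof.
move=> noethR; apply: contrapT => nfg.
have /choice[nxt nxtP] (s : seq R) : exists x, (forall y, y \in s -> S y) ->
    S x /\ ~ in_span (nth 0 s) (size s) x.
  have [sS|nsS] := pselect (forall y, y \in s -> S y); last by exists 0.
  apply: contrapT => /forallNP nex; apply: nfg; exists (size s), (nth 0 s).
  split=> [i lti|x Sx]; first exact/sS/mem_nth.
  by apply: contrapT => nx; apply: (nex x).
pose l k := iter k (fun s => rcons s (nxt s)) [::].
have size_l k : size (l k) = k by elim: k => //= k IH; rewrite size_rcons IH.
have lS k y : y \in l k -> S y.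
  elim: k y => //= k IH y; rewrite mem_rcons inE => /orP[/eqP->|/IH//].
  by have [] := nxtP _ IH.
have nth_l i k : (i < k)%N -> nth 0 (l k) i = nxt (l i).
  elim: k => //= k IH; rewrite ltnS nth_rcons size_l leq_eqVlt.
  by case/orP => [/eqP->|ltik]; rewrite ?ltnn ?eqxx // ltik IH.
have [N [c uN]] := noethR (fun k => nxt (l k)).
have [_ []] := nxtP (l N) (@lS N); rewrite size_l.
by exists c; rewrite uN; apply: eq_bigr => i _; rewrite nth_l.
Qed.

End Noetherian.

Lemma noetherian_surj (R S : comNzRingType) (phi : {rmorphism R -> S}) :
  (forall y, exists x, phi x = y) -> noetherian R -> noetherian S.
Proof.
move=> /choice[psi psiK] noethR u; have [N [c uN]] := noethR (psi \o u).
exists N, (fun i => phi (c i)); rewrite -(psiK (u N)).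
move: uN => /= ->; rewrite rmorph_sum; apply: eq_bigr => i _.
by rewrite rmorphM /= psiK.
Qed.

(* With [J N] the ideal generated by [u 0], ..., [u (N - 1)], choose [p N] in
   [J (N + 1)] outside [J N] with least leading monomial: by Dickson's lemma
   some [p j] can be reduced modulo an earlier [p i]. *)
Lemma mpoly_noetherian (K : fieldType) n : noetherian {mpoly K[n]}.
Proof.
move=> u; apply: contrapT => /forallNP nspan.
have /choice[p pP] N : exists p, [/\ in_span u N.+1 p, ~ in_span u N p &
    forall q, in_span u N.+1 q -> ~ in_span u N q -> (mlead p <= mlead q)%O].
  apply: contrapT => /forallNP nmin.
  (* Without a minimal choice, well-founded induction on the leading monomial puts all of
     [J (N + 1)], hence [u N], into [J N]. *)
  suff none m q : mlead q = m -> in_span u N.+1 q -> in_span u N q.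
    exact: nspan _ (none _ _ erefl (in_span_gen u (ltnSn N))).
  elim/(well_founded_ind (@ltom_wf n)): m q => m IH q mq uq.
  apply: contrapT => nq; apply: (nmin q); split=> // q' uq' nq'.
  rewrite leNgt; apply/negP => lt_q'; apply: nq'.
  by apply: (IH (mlead q')) => //; rewrite -mq.
have [i [j [ltij leij]]] := dickson (fun k => mlead (p k)).
have [upi npi _] := pP i; have [upj npj minj] := pP j.
(* [w * p i] cancels the leading term of [p j], while minimality of [p j] forces the sum [q] to have
   that same leading monomial. *)
pose w := - ((mleadc (p j) / mleadc (p i)) *: 'X_[mlead (p j) - mlead (p i)]).
have Jpi : in_span u j (p i) by apply: in_span_le upi.
pose q := w * p i + p j.
have nq : ~ in_span u j q.
  move=> /(in_span_comb (- w) Jpi); rewrite /q addrA mulNr addNr add0r.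
  exact: npj.
have uq : in_span u j.+1 q by apply: in_span_comb => //; exact: in_span_le Jpi.
have pi0 : p i != 0.
  apply/eqP => pi0; apply: npi; rewrite pi0; exists (fun=> 0).
  by rewrite big1 // => k _; rewrite mul0r.
have q0 : q != 0.
  apply/eqP => q0; apply: nq; rewrite q0; exists (fun=> 0).
  by rewrite big1 // => k _; rewrite mul0r.
have lead_w : (mlead (w * p i) <= mlead (p j))%O.
  apply: le_trans (mleadM_le _ _) _; rewrite -(submK leij) lemc_add2l.
  rewrite /w mleadN; apply: le_trans (mleadZ_le _ _) _.
  by rewrite mleadXm.
have lead_q : mlead q = mlead (p j).
  apply/eqP; rewrite eq_le minj // andbT.
  by apply: le_trans (mleadD_le _ _) _; rewrite leUx lead_w lexx.
move: q0; rewrite -mleadc_eq0 lead_q mcoeffD /w mulNr -scalerAl mcoeffN mcoeffZ.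
have -> : ('X_[mlead (p j) - mlead (p i)] * p i)@_(mlead (p j)) = mleadc (p i).
  by rewrite -[in X in _@_X](submK leij) mulrC mcoeffMX.
by rewrite divfK ?mleadc_eq0 // addNr eqxx.
Qed.

(** * Krull's intersection theorem *)

Section Krull.
Variables (K : fieldType) (n : nat) (A : idomainType).
Variable phi : {rmorphism {mpoly K[n]} -> A}.
Hypothesis phi_surj : forall y, exists x, phi x = y.
Variable I : set A.
Hypothesis I0 : I 0.
Hypothesis ID : forall x y, I x -> I y -> I (x + y).
Hypothesis IM : forall x y, I y -> I (x * y).

(* The image of [rees a] is the Rees algebra of the ideal generated by the
   [a j]. *)
Definition rees r (a : 'I_r -> A) : {rmorphism {mpoly K[n + r]} -> {poly A}} :=
  mmap (polyC \o phi \o @mpolyC n K)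
    (fun k => match split k with
              | inl i => (phi 'X_i)%:P
              | inr j => a j *: 'X
              end).

(** Rewrite a preimage of [c] under [phi] in the first [n] of the [n + r] variables. *)
Lemma rees_polyC r (a : 'I_r -> A) c : exists U, rees a U = c%:P.
Proof.
have [p <-] := phi_surj c.
exists (p \mPo [tuple 'X_(lshift r i) | i < n]).
elim/mpolyind: p => [|c' m p _ _ IH]; first by rewrite !rmorph0.
rewrite !rmorphD /= IH; congr (_ + _).
rewrite comp_mpolyZ comp_mpolyX -!mul_mpolyC !rmorphM /= mmapC; congr (_ * _).
rewrite rmorph_prod mpolyXE_id !rmorph_prod; apply: eq_bigr => i _.
by rewrite tnth_mktuple !rmorphXn /= mmapX mmap1U -[lshift r i]/(unsplit (inl i)) unsplitK.
Qed.

Lemma rees_gen r (a : 'I_r -> A) j : exists U, rees a U = a j *: 'X.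
Proof.
by exists 'X_(rshift n j); rewrite /= mmapX mmap1U -[rshift n j]/(unsplit (inr j)) unsplitK.
Qed.

(** The polynomials with all coefficients of positive degree in [I] are closed under sums and
    products, and contain the constants and the images of the variables. *)
Lemma rees_coef r (a : 'I_r -> A) : (forall j, I (a j)) ->
  forall U k, I (rees a U)`_k.+1.
Proof.
move=> Ia.
pose B : set {poly A} := [set q | forall k, I q`_k.+1].
have B1 : B 1 by move=> k; rewrite coef1.
have BD x y : B x -> B y -> B (x + y).
  by move=> Bx By k; rewrite coefD; exact: ID.
have BM x y : B x -> B y -> B (x * y).
  move=> Bx By k; rewrite coefM; apply: (big_ind I) => // -[[|l] /= _] _.
    by rewrite subn0; exact: IM.
  by rewrite mulrC; exact: IM.
move=> U; rewrite -/(B (rees a U)) /= /mmap; apply: (big_ind B) => //.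
  by move=> k; rewrite coef0.
move=> m _; apply: (BM _ _) => /=; first by move=> k; rewrite coefC.
apply: (big_ind B) => // i _; elim: (m i) => [|l IH]; first by rewrite expr0.
rewrite exprS; apply: (BM _ _ _ IH) => k; case: split => j; first by rewrite coefC.
by rewrite coefZ coefX mulrC; exact: IM.
Qed.

(* The elements [(s k * f) *: 'X^k] lie in the Noetherian Rees algebra, so one of
   them is a combination of the previous ones; comparing the coefficients of
   ['X^N] gives [s N * f = e * f] with [e] in [I], while [s N] is not. *)
Lemma krull_intersection f :
  (forall k, exists s, ~ I s /\ ideal_power I k (s * f)) -> f = 0.
Proof.
move=> /choice[s sP].
have [r [a [Ia gen]]] :=
  noetherian_fg I (noetherian_surj phi_surj (@mpoly_noetherian K n)).
pose a' (j : 'I_r) := a j.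
pose Im : set {poly A} := [set q | exists U, rees a' U = q].
have ImD x y : Im x -> Im y -> Im (x + y).
  by move=> [U <-] [V <-]; exists (U + V); rewrite rmorphD.
have ImM x y : Im x -> Im y -> Im (x * y).
  by move=> [U <-] [V <-]; exists (U * V); rewrite rmorphM.
have Im0 : Im 0 by exists 0; rewrite rmorph0.
have Im1 : Im 1 by exists 1; rewrite rmorph1.
have ImI x : I x -> Im (x *: 'X).
  move=> /gen[c ->]; rewrite scaler_suml; apply: (big_ind Im) => // j _.
  rewrite -scalerA -mul_polyC; apply: (ImM _ _); first exact: rees_polyC.
  exact: (rees_gen a' j).
have /choice[U UP] k : exists U, rees a' U = (s k * f) *: 'X^k.
  have [t [tI ->]] := (sP k).2; rewrite scaler_suml big_seq.
  apply: (big_ind Im) => // u /tI uI.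
  rewrite -scalerA -mul_polyC; apply: (ImM _ _); first exact: rees_polyC.
  have -> : (\prod_(i < k) tnth u.2 i) *: 'X^k = \prod_(i < k) (tnth u.2 i *: 'X).
    by rewrite scaler_prod prodr_const card_ord.
  by apply: (big_ind Im) => // i _; exact: (ImI _ (uI i)).
have [N [c]] := @mpoly_noetherian K (n + r) U.
move=> /(congr1 (rees a')) /(congr1 (fun q : {poly A} => q`_N)).
rewrite UP rmorph_sum coef_sum coefZ coefXn eqxx mulr1.
pose e (i : 'I_N) := (rees a' (c i))`_(N - i) * s i.
rewrite (eq_bigr (fun i => e i * f)); last first.
  move=> i _; rewrite rmorphM UP -scalerAr coefZ coefMXn ltnNge (ltnW (ltn_ord i)) /=.
  by rewrite /e mulrC mulrA.
rewrite -mulr_suml => /eqP; rewrite -subr_eq0 -mulrBl mulf_eq0.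
case/orP => [|/eqP //]; rewrite subr_eq0 => /eqP sN.
case: (sP N).1; rewrite sN; apply: (big_ind I) => // i _.
(* As [i < N], the degree [N - i] is positive and [rees_coef] applies. *)
rewrite /e mulrC; apply: IM; have := ltn_ord i; rewrite -subn_gt0.
by case: (N - i)%N => // l _; apply: rees_coef => j; apply: Ia.
Qed.

End Krull.

(** * Closed sets and prime divisors *)

Section Zariski.
Variables (K : closedFieldType) (n : nat).
Implicit Types (Z : set 'rV[K]_n) (p q : {mpoly K[n]}).

Definition hypersurface p : set 'rV[K]_n := [set x | p.@[x 0] = 0].

Lemma hypersurface_closed p : zariski_closed (hypersurface p).
Proof.
by exists [set p]; apply/seteqP; split => [x px q -> //|x /(_ p erefl)].
Qed.

Lemma zariski_closedI Z1 Z2 :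
  zariski_closed Z1 -> zariski_closed Z2 -> zariski_closed (Z1 `&` Z2).
Proof.
move=> [S1 ->] [S2 ->]; exists (S1 `|` S2); apply/seteqP; split=> x /=.
  by move=> [h1 h2] p [/h1|/h2].
by move=> h; split=> p Sp; apply: h; [left|right].
Qed.

Lemma zariski_closed_separate Z x : zariski_closed Z -> ~ Z x ->
  exists p, Z `<=` hypersurface p /\ p.@[x 0] != 0.
Proof.
move=> [S ->] nZ; apply: contrapT => /forallNP nsep; apply: nZ => p Sp.
apply/eqP/negPn/negP => px; apply: (nsep p); split=> // y; exact.
Qed.

(** Noetherian induction. A failure gives a strictly decreasing chain [W] of closed sets and
    polynomials [p k] vanishing on [W k.+1] but not on [W k]. Some [p N] is a combination of earlier
    ones, all of which vanish on [W N]. *)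
Lemma zariski_closed_ind (P : set 'rV[K]_n -> Prop) :
  (forall Z, zariski_closed Z ->
     (forall Z', zariski_closed Z' -> Z' `<` Z -> P Z') -> P Z) ->
  forall Z, zariski_closed Z -> P Z.
Proof.
move=> IH Z0 cZ0; apply: contrapT => nP0.
have /choice[nxt nxtP] Z : exists Z', zariski_closed Z -> ~ P Z ->
    [/\ zariski_closed Z', Z' `<` Z & ~ P Z'].
  apply: contrapT => /forallNP nex; apply: (nex Z) => cZ nP; case: nP.
  apply: IH => // Z' cZ' ltZ'; apply: contrapT => nP'.
  by apply: (nex Z').
pose W k := iter k nxt Z0.
have WP k : zariski_closed (W k) /\ ~ P (W k).
  by elim: k => //= k [cW nPW]; have [] := nxtP _ cW nPW.
have ltW k : W k.+1 `<` W k by have [cW nPW] := WP k; have [] := nxtP _ cW nPW.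
have leW i j : (i <= j)%N -> W j `<=` W i.
  move=> /subnK <-; elim: (j - i)%N => //= k IHk.
  exact: subset_trans (properW (ltW _)) IHk.
have /choice[p pP] k : exists p, W k.+1 `<=` hypersurface p /\
    ~ W k `<=` hypersurface p.
  have [_ /existsNP[x /not_implyP[Wx nWx]]] := ltW k.
  have [p [Wp px]] := zariski_closed_separate (WP k.+1).1 nWx.
  by exists p; split=> // /(_ x Wx) px0; rewrite px0 eqxx in px.
have [N [c pN]] := mpoly_noetherian p.
apply: (pP N).2 => x Wx; rewrite /hypersurface /= pN raddf_sum big1 // => i _.
by rewrite /= mevalM ((pP i).1 x) ?mulr0 //; apply: leW Wx; exact: ltn_ord.
Qed.

Lemma not_irreducible Z : Z !=set0 -> ~ zariski_irreducible Z ->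
  exists Z1 Z2, [/\ zariski_closed Z1, zariski_closed Z2, Z `<=` Z1 `|` Z2,
    ~ Z `<=` Z1 & ~ Z `<=` Z2].
Proof.
move=> Z0; apply: contra_notP => /forallNP nex; split=> // Z1 Z2 c1 c2 sub.
apply: contrapT => /not_orP[n1 n2]; apply: (nex Z1); exists Z2; split=> //.
Qed.

End Zariski.

Section Divisors.
Variables (K : closedFieldType) (n : nat) (X : affineVariety K n).
Implicit Types (D : primeDivisor X) (p : {mpoly K[n]}).

(** By codimension one, a strictly larger [D'] would be all of [X]; the remaining fields are proofs,
    equal by proof irrelevance. *)
Lemma primeDivisor_eq D D' : D `<=` D' -> D = D'.
Proof.
move=> sub; have eqp : divisor_points D = divisor_points D'.
  apply: contrapT => neq.
  have : divisor_points D' = points X.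
    apply: (divisor_codim1 (p := D)); [exact: divisor_closed|
      exact: divisor_irreducible| |exact: properW (divisor_proper D')].
    by rewrite properEneq; split=> //; apply/eqP.
  by move=> eX; have [] := divisor_proper D'; rewrite eX.
case: D D' {sub} eqp => [Z a b c e] [Z' a' b' c' e'] /= eqZ; subst Z'.
by congr PrimeDivisor; exact: Prop_irrelevance.
Qed.

(* By Noetherian induction on [Z]; when [Z] is irreducible, the only candidate
   is [Z] itself. *)
Lemma finitely_many_divisors (Z : set 'rV[K]_n) :
  zariski_closed Z -> Z `<` X ->
  exists s : seq (primeDivisor X), forall D, D `<=` Z -> D \in s.
Proof.
move: Z; apply: zariski_closed_ind => Z cZ IH ltZX.
have [irrZ|nirrZ] := pselect (zariski_irreducible Z).
  have onlyZ D : D `<=` Z -> divisor_points D = Z.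
    move=> leDZ; apply: contrapT => neDZ; have [leZX nleXZ] := ltZX; apply: nleXZ.
    rewrite (@divisor_codim1 _ _ _ D Z) // properEneq; split=> //; exact/eqP.
  have [[D0 D0Z]|noD] := pselect (exists D, D `<=` Z); last first.
    by exists [::] => D DZ; case: noD; exists D.
  exists [:: D0] => D DZ; rewrite inE; apply/eqP/primeDivisor_eq.
  by rewrite (onlyZ D) // -(onlyZ D0).
have [Z0|/set0P/negP/negPn/eqP Z0] := pselect (Z !=set0); last first.
  exists [::] => D; rewrite Z0 => D0.
  by have [[x /D0]] := divisor_irreducible D.
have [Z1 [Z2 [c1 c2 sub n1 n2]]] := not_irreducible Z0 nirrZ.
(* An irreducible [D] inside [Z] lies in [Z1] or [Z2], so it suffices to list the divisors in two
   strictly smaller closed sets. *)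
have part Z' : zariski_closed Z' -> ~ Z `<=` Z' ->
    exists s : seq (primeDivisor X), forall D, D `<=` Z `&` Z' -> D \in s.
  move=> c' n'; have leZ : Z `&` Z' `<` Z by split=> // le; apply: n' => x /le[].
  apply: IH => //; first exact: zariski_closedI.
  by have [leZX nleXZ] := ltZX; split=> [x [/leZX]|leX] //; apply: nleXZ => x /leX[].
have [s1 s1P] := part _ c1 n1; have [s2 s2P] := part _ c2 n2.
exists (s1 ++ s2) => D DZ; rewrite mem_cat.
have [_ irrD] := divisor_irreducible D.
have [D1|D2] := irrD _ _ c1 c2 (subset_trans DZ sub).
  by rewrite s1P // => x Dx; split; [exact: DZ|exact: D1].
by rewrite orbC s2P // => x Dx; split; [exact: DZ|exact: D2].
Qed.

(** * The projection from polynomials onto the coordinate ring *)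

Definition coord_pi (p : {mpoly K[n]}) : coordRing X :=
  \pi_{ideal_quot (vanishing_ideal X)} p.

Lemma coord_pi_monoid_morphism : monoid_morphism coord_pi.
Proof. by split=> [|p q]; rewrite /coord_pi ?rmorph1 ?rmorphM. Qed.

Lemma coord_pi_zmod_morphism : zmod_morphism coord_pi.
Proof. by move=> p q; rewrite /coord_pi rmorphB. Qed.

HB.instance Definition _ := GRing.isZmodMorphism.Build _ _ coord_pi
  coord_pi_zmod_morphism.
HB.instance Definition _ := GRing.isMonoidMorphism.Build _ _ coord_pi
  coord_pi_monoid_morphism.

Lemma coord_pi_surj a : exists p, coord_pi p = a.
Proof. by exists (repr a); rewrite /coord_pi reprK. Qed.

Lemma coord_eval_pi p x : points X x -> coord_eval (coord_pi p) x = p.@[x 0].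
Proof.
move=> Xx; apply/eqP; rewrite -subr_eq0 -mevalB; apply/eqP.
suff /vanishing_idealP -> : repr (coord_pi p) - p \in vanishing_ideal X by [].
by rewrite Quotient.idealrBE; apply/eqP; rewrite /coord_pi reprK.
Qed.
End Divisors.

(** * Orders of regular functions *)

Section Orders.
Variables (K : closedFieldType) (n : nat) (X : affineVariety K n).
Implicit Types (D : primeDivisor X) (a b : coordRing X).

Lemma divisor_sub D : D `<=` X. Proof. exact: properW (divisor_proper D). Qed.

Lemma coord_evalD a b x : points X x ->
  coord_eval (a + b) x = coord_eval a x + coord_eval b x.
Proof.
have [p <-] := coord_pi_surj a; have [q <-] := coord_pi_surj b => Xx.
by rewrite -rmorphD !coord_eval_pi // mevalD.
Qed.

Lemma coord_evalM a b x : points X x ->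
  coord_eval (a * b) x = coord_eval a x * coord_eval b x.
Proof.
have [p <-] := coord_pi_surj a; have [q <-] := coord_pi_surj b => Xx.
by rewrite -rmorphM !coord_eval_pi // mevalM.
Qed.

Lemma coord_eval0 x : points X x -> coord_eval (0 : coordRing X) x = 0.
Proof. by move=> Xx; rewrite -(rmorph0 (@coord_pi K n X)) coord_eval_pi ?meval0. Qed.

Lemma coord_eval1 x : points X x -> coord_eval (1 : coordRing X) x = 1.
Proof. by move=> Xx; rewrite -(rmorph1 (@coord_pi K n X)) coord_eval_pi ?meval1. Qed.

Lemma divisor_ideal0 D : divisor_ideal D 0.
Proof. by move=> x /divisor_sub; exact: coord_eval0. Qed.

Lemma divisor_idealD D a b :
  divisor_ideal D a -> divisor_ideal D b -> divisor_ideal D (a + b).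
Proof.
by move=> Ia Ib x Dx; rewrite coord_evalD ?Ia ?Ib ?addr0 //; exact: divisor_sub Dx.
Qed.

Lemma divisor_idealM D a b : divisor_ideal D b -> divisor_ideal D (a * b).
Proof.
by move=> Ib x Dx; rewrite coord_evalM ?Ib ?mulr0 //; exact: divisor_sub Dx.
Qed.

Lemma divisor_ideal1 D : ~ divisor_ideal D 1.
Proof.
have [[x Dx] _] := divisor_irreducible D => /(_ x Dx) /eqP.
by rewrite coord_eval1 ?oner_eq0 //; exact: divisor_sub Dx.
Qed.

Lemma divisor_ideal_pi D p :
  divisor_ideal D (coord_pi X p) <-> D `<=` hypersurface p.
Proof.
by split=> ID x Dx; have := ID x Dx; rewrite /hypersurface /= coord_eval_pi //;
  exact: divisor_sub Dx.
Qed.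

Lemma divisor_ideal_prime D a b :
  divisor_ideal D (a * b) -> divisor_ideal D a \/ divisor_ideal D b.
Proof.
have [p <-] := coord_pi_surj a; have [q <-] := coord_pi_surj b.
rewrite -rmorphM !divisor_ideal_pi => Dpq.
have [_ irrD] := divisor_irreducible D.
apply: irrD; [exact: hypersurface_closed|exact: hypersurface_closed|].
move=> x /Dpq; rewrite /hypersurface /= mevalM => /eqP.
by rewrite mulf_eq0 => /orP[]/eqP; [left|right].
Qed.

Lemma ideal_power_sub D k a :
  ideal_power (divisor_ideal D) k.+1 a -> divisor_ideal D a.
Proof.
move=> [s [sI ->]]; rewrite big_seq.
apply: (big_ind (divisor_ideal D)) => [|x y|t /sI tI].
- exact: divisor_ideal0.
- exact: divisor_idealD.
apply: divisor_idealM; rewrite big_ord_recl mulrC.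
exact/divisor_idealM/tI.
Qed.

Lemma ideal_power0 (R : comNzRingType) (I : set R) (a : R) : ideal_power I 0 a.
Proof.
exists [:: (a, [tuple])]; split=> [t _ []//|].
by rewrite big_seq1 big_ord0 mulr1.
Qed.

(** Clearing the denominator gives the form required by [krull_intersection]. *)
Lemma local_powerP D k a : local_power D k (to_functionField a) ->
  exists s, ~ divisor_ideal D s /\ ideal_power (divisor_ideal D) k (s * a).
Proof.
move=> [b [s [bI sI eq_ab]]]; exists s; split=> //.
suff -> : s * a = b by [].
have s0 : to_functionField s != 0.
  by rewrite tofrac_eq0; apply/eqP => s0; apply: sI; rewrite s0; exact: divisor_ideal0.
apply/eqP; rewrite -tofrac_eq tofracM; apply/eqP.
by rewrite [_ a]eq_ab mulrC divfK.
Qed.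

Lemma local_power0 D a : local_power D 0 (to_functionField a).
Proof.
exists a, 1; split; [exact: ideal_power0|exact: divisor_ideal1|].
by rewrite /to_functionField tofrac1 divr1.
Qed.

Lemma local_power1 D a : divisor_ideal D a -> local_power D 1 (to_functionField a).
Proof.
move=> Ia; exists a, 1; split; [|exact: divisor_ideal1|].
  exists [:: (1, [tuple a])]; split=> [t|]; last by rewrite big_seq1 big_ord1 mul1r.
  by rewrite inE => /eqP -> i /=; rewrite ord1.
by rewrite /to_functionField tofrac1 divr1.
Qed.

Lemma local_power_ideal D k a :
  local_power D k.+1 (to_functionField a) -> divisor_ideal D a.
Proof.
by move=> /local_powerP[s [nIs /ideal_power_sub /divisor_ideal_prime[]]].
Qed.

(** By Krull's theorem [a] leaves the powers of the maximal ideal at some point. The second clause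
    makes the divisor of [a] effective, with the prime divisors in its zero locus as support. *)
Lemma has_order_regular D a : a != 0 ->
  exists k : nat, has_order D (to_functionField a) k%:Z /\
    (divisor_ideal D a <-> (0 < k)%N).
Proof.
move=> a0.
have [k0 nk0] : exists k, ~ local_power D k (to_functionField a).
  apply: contrapT => /forallNP all_k; move/eqP: a0; apply.
  apply: (krull_intersection (@coord_pi_surj K n X) (@divisor_ideal0 D)
    (@divisor_idealD D) (@divisor_idealM D)) => k.
  by apply: local_powerP; apply: contrapT; exact: all_k.
have /ex_minnP[k /asboolP nk mink] : exists k, `[< ~ local_power D k (to_functionField a) >].
  by exists k0; apply/asboolP.
(* The power with exponent 0 contains [a], so the least excluded exponent is a successor; its
   predecessor is the order. *)
case: k nk mink => [|k] nk mink; first by case: nk; exact: local_power0.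
have lk : local_power D k (to_functionField a).
  apply: contrapT => nlk; have := mink k; rewrite ltnn => /(_ _)/negP; apply=> //.
  exact/asboolP.
exists k; split; last first.
  split=> [Ia|]; last by case: k lk {nk mink} => // k /local_power_ideal.
  by case: k nk {lk mink} => // -[]; exact: local_power1.
exists a, 1, k, 0%N; split; rewrite ?subr0 ?oner_eq0 //.
  by rewrite /to_functionField tofrac1 divr1.
by split; [exact: local_power0|move/local_power_ideal; exact: divisor_ideal1].
Qed.

End Orders.

(** * Weights of the torus *)

(** Uniqueness of base [B] expansions: reduction modulo [B] isolates the lowest digit. *)
Lemma digits_inj (B d : nat) (m m' : 'I_d -> nat) :
  (forall i, m i < B)%N -> (forall i, m' i < B)%N ->
  (\sum_i m i * B ^ i = \sum_i m' i * B ^ i)%N -> m =1 m'.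
Proof.
elim: d m m' => [|d IH] m m' ltm ltm'; first by move=> _ [].
have B0 : (0 < B)%N by exact: leq_ltn_trans (ltm ord0).
have split_sum (f : 'I_d.+1 -> nat) : (\sum_i f i * B ^ i =
    (\sum_i f (fintype.lift ord0 i) * B ^ i) * B + f ord0)%N.
  rewrite big_ord_recl expn0 muln1 addnC big_distrl; congr (_ + _)%N.
  by apply: eq_bigr => i _; rewrite expnSr mulnA.
rewrite !split_sum => eqm.
have eq0 : m ord0 = m' ord0.
  by have := congr1 (modn^~ B) eqm; rewrite /= !modnMDl !modn_small.
move: eqm; rewrite eq0 => /addIn /eqP; rewrite eqn_pmul2r // => /eqP.
move=> /IH eq_lift i; case: (unliftP ord0 i) => [j|] -> //.
by apply: eq_lift => k; [exact: ltm|exact: ltm'].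
Qed.

(* Kronecker substitution: for a large base [B], the powers [u ^ (B ^ i)]
   separate the monomials of [p]; a root [u] of ['X * q - 1] is nonzero and
   does not annihilate [q]. *)
Lemma mpoly_nonvanishing (K : closedFieldType) d (p : {mpoly K[d]}) : p != 0 ->
  exists v : 'I_d -> K, (forall i, v i != 0) /\ p.@[v] != 0.
Proof.
move=> p0; pose B := msize p.
pose enc (m : 'X_{1..d}) := (\sum_i m i * B ^ i)%N.
have ltB m i : m \in msupp p -> (m i < B)%N.
  move=> /msize_mdeg_lt; apply: leq_ltn_trans.
  by rewrite mdegE (bigD1 i) //= leq_addr.
pose q := \sum_(m <- msupp p) p@_m *: 'X^(enc m).
have q0 : q != 0.
  apply/eqP => q0; have lp := mlead_supp p0; move: p0; rewrite -mleadc_eq0.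
  (* [enc] is injective on the support of [p], so no other monomial contributes to this
     coefficient. *)
  suff <- : q`_(enc (mlead p)) = mleadc p by rewrite q0 coef0 eqxx.
  rewrite coef_sum (bigD1_seq (mlead p)) ?msupp_uniq //= coefZ coefXn eqxx mulr1.
  rewrite big_seq_cond big1 ?addr0 // => m /andP[mp neqm].
  rewrite coefZ coefXn; case: eqP => [enc_eq|_]; last by rewrite mulr0.
  by case/eqP: neqm; apply/mnmP; apply: digits_inj (esym enc_eq) => i; exact: ltB.
have /closed_rootP[u] : size ('X * q - 1) != 1%N.
  rewrite size_addl ?size_opp ?size_poly1 ?size_mulX //.
    by rewrite mulrC size_mulX // eqSS size_poly_eq0.
  by rewrite mulrC size_mulX // ltnS lt0n size_poly_eq0.
rewrite /root !hornerE subr_eq0 => /eqP uq.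
have u0 : u != 0.
  by apply/eqP => u0; have := oner_neq0 K; rewrite -uq u0 mul0r eqxx.
exists (fun i => u ^+ (B ^ i)); split=> [i|]; first exact: expf_neq0.
suff -> : p.@[fun i => u ^+ (B ^ i)] = q.[u].
  by apply/eqP => qu; have := oner_neq0 K; rewrite -uq qu mulr0 eqxx.
rewrite mevalE horner_sum; apply: eq_bigr => m _.
rewrite !hornerE; congr (_ * _); rewrite /enc expr_sum.
by apply: eq_bigr => i _; rewrite -exprM mulnC.
Qed.

Section TorusWeights.
Variables (K : closedFieldType) (d n : nat).
Implicit Types (t : 'rV[K]_(d + d)) (y : 'rV[K]_n).
Implicit Types (H : {mpoly K[(d + d) + n]}).

Definition torus_coord t (i : 'I_d) : K := t 0 (lshift d i).

Lemma torus_coord_neq0 t i : torus t -> torus_coord t i != 0.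
Proof.
by move=> /(_ i) ti; apply/eqP => t0; have := oner_neq0 K;
  rewrite -ti -/(torus_coord t i) t0 mul0r eqxx.
Qed.

Lemma torus_coord_surj (v : 'I_d -> K) : (forall i, v i != 0) ->
  exists2 t, torus t & torus_coord t =1 v.
Proof.
move=> v0; exists (row_mx (\row_i v i) (\row_i (v i)^-1)) => i.
  by rewrite row_mxEl row_mxEr !mxE divff.
by rewrite /torus_coord row_mxEl mxE.
Qed.

Lemma torus_mul_in t t' : torus t -> torus t' -> torus (torus_mul t t').
Proof. by move=> Tt Tt' i; rewrite !mxE mulrACA Tt Tt' mulr1. Qed.

Lemma torus_one_in : torus (torus_one K d).
Proof. by move=> i; rewrite !mxE mulr1. Qed.

Lemma torus_coord_mul t t' i :
  torus_coord (torus_mul t t') i = torus_coord t i * torus_coord t' i.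
Proof. by rewrite /torus_coord mxE. Qed.

(* On the torus, [H] is a Laurent polynomial in the first [d] coordinates with
   coefficients in [K[y]]; the exponents are shifted by [msize H] to make them
   nonnegative. *)
Definition torus_exp H (m : 'X_{1..(d + d) + n}) : 'X_{1..d} :=
  [multinom m (lshift n (lshift d i)) +
     (msize H - m (lshift n (rshift d i))) | i < d]%N.

Definition rest_exp (m : 'X_{1..(d + d) + n}) : 'X_{1..n} :=
  [multinom m (rshift (d + d) j) | j < n].

(** The coefficient, a polynomial in [y], of the character of shifted exponent [w]. *)
Definition weight_part H (w : 'X_{1..d}) : {mpoly K[n]} :=
  \sum_(m <- msupp H | torus_exp H m == w) H@_m *: 'X_[rest_exp m].

Definition laurent H y : {mpoly K[d]} :=
  \sum_(m <- msupp H) (H@_m * 'X_[rest_exp m].@[y 0]) *: 'X_[torus_exp H m].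

Lemma laurent_coef H y w : (laurent H y)@_w = (weight_part H w).@[y 0].
Proof.
rewrite /laurent /weight_part !raddf_sum /= [RHS]big_mkcond; apply: eq_bigr => m _.
rewrite mcoeffZ mcoeffX mevalZ; case: ifP => _; by rewrite ?mulr1 ?mulr0.
Qed.

Lemma laurentE H t y : torus t ->
  (laurent H y).@[torus_coord t] =
  (\prod_i torus_coord t i) ^+ msize H * H.@[(row_mx t y) 0].
Proof.
move=> Tt; rewrite /laurent raddf_sum [in RHS]mevalE mulr_sumr big_seq [in RHS]big_seq.
apply: eq_bigr => m mH /=; rewrite mevalZ -mulrA [RHS]mulrCA; congr (_ * _).
rewrite !mevalX big_split_ord /= mulrCA [RHS]mulrA [RHS]mulrC; congr (_ * _).
  by apply: eq_bigr => j _; rewrite row_mxEr mnmE.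
rewrite big_split_ord /= -prodrXl -!big_split; apply: eq_bigr => i _ /=.
rewrite !row_mxEl mnmE -/(torus_coord t i).
set a := m (lshift _ _); set b := m (lshift _ _).
(* This makes the truncated subtraction in [torus_exp] exact. *)
have leb : (b <= msize H)%N.
  apply/ltnW/(leq_ltn_trans _ (msize_mdeg_lt mH)).
  by rewrite mdegE (bigD1 (lshift n (rshift d i))) //= leq_addr.
have tb : t 0 (rshift d i) ^+ b * torus_coord t i ^+ b = 1.
  by rewrite mulrC -exprMn Tt expr1n.
by rewrite exprD -[in RHS](subnK leb) exprD [RHS]mulrACA tb mulr1.
Qed.

Lemma laurent_eq0 H y :
  (forall t, torus t -> H.@[(row_mx t y) 0] = 0) -> laurent H y = 0.
Proof.
move=> H0; apply/eqP; apply: contrapT => /negP.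
move=> /mpoly_nonvanishing[v [/torus_coord_surj[t Tt tv]]].
by rewrite -(meval_eq _ tv) laurentE // H0 // mulr0 eqxx.
Qed.

(** Irreducibility of the torus: the polynomial ring containing both [laurent] polynomials is a
    domain. *)
Lemma torus_polynomial_prime H H' y :
  (forall t, torus t -> H.@[(row_mx t y) 0] * H'.@[(row_mx t y) 0] = 0) ->
  (forall t, torus t -> H.@[(row_mx t y) 0] = 0) \/
  (forall t, torus t -> H'.@[(row_mx t y) 0] = 0).
Proof.
move=> HH'0.
have vanish (G : {mpoly K[(d + d) + n]}) : laurent G y = 0 ->
    forall t, torus t -> G.@[(row_mx t y) 0] = 0.
  move=> G0 t Tt; have := laurentE G y Tt; rewrite G0 meval0 => /esym/eqP.
  rewrite mulf_eq0 expf_eq0 => /orP[/andP[_]|/eqP//].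
  by rewrite prodf_seq_eq0 => /hasP[i _ /=]; rewrite (negPf (torus_coord_neq0 i Tt)).
have : laurent H y * laurent H' y == 0.
  apply/negPn/negP => /mpoly_nonvanishing[v [/torus_coord_surj[t Tt tv]]].
  by rewrite -(meval_eq _ tv) mevalM !laurentE // mulrACA HH'0 // mulr0 eqxx.
by rewrite mulf_eq0 => /orP[]/eqP/vanish; [left|right].
Qed.

(** Translation by [s] multiplies the part of weight [w] by a nonzero scalar, the value of a
    character at [s]. *)
Lemma weight_part_translate H s y y' w : torus s ->
  (forall t, torus t ->
     H.@[(row_mx t y') 0] = H.@[(row_mx (torus_mul t s) y) 0]) ->
  (weight_part H w).@[y 0] = 0 -> (weight_part H w).@[y' 0] = 0.
Proof.
move=> Ts eqH; rewrite -!laurent_coef => w0.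
pose c := (\prod_i torus_coord s i) ^+ msize H.
(* [scaled] is [laurent H y] with its variables multiplied by the coordinates of [s]; it agrees with
   [c *: laurent H y'] on the torus, hence identically. *)
pose scaled := \sum_(m <- msupp (laurent H y))
  ((laurent H y)@_m * \prod_i torus_coord s i ^+ m i) *: 'X_[m].
have c0 : c != 0.
  by rewrite expf_neq0 //; apply/prodf_neq0 => i _; exact: torus_coord_neq0.
have : c *: laurent H y' - scaled = 0.
  apply/eqP/negPn/negP => /mpoly_nonvanishing[v [/torus_coord_surj[t Tt tv]]].
  rewrite -(meval_eq _ tv) mevalB mevalZ laurentE // eqH //.
  have -> : scaled.@[torus_coord t] = (laurent H y).@[torus_coord (torus_mul t s)].
    rewrite raddf_sum [RHS]mevalE; apply: eq_bigr => m _ /=.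
    rewrite mevalZ mevalX -mulrA -big_split; congr (_ * _); apply: eq_bigr => i _.
    by rewrite torus_coord_mul exprMn mulrC.
  rewrite laurentE ?mulrA -?exprMn -?big_split; last exact: torus_mul_in.
  rewrite (eq_bigr (torus_coord (torus_mul t s))) ?subrr ?eqxx // => i _.
  by rewrite torus_coord_mul mulrC.
move=> /(congr1 (mcoeff w)); rewrite mcoeffB mcoeffZ mcoeff0 => /eqP.
rewrite [scaled@__](_ : _ = 0) ?subr0 ?mulf_eq0 ?(negPf c0) => [/eqP//|].
rewrite raddf_sum big1 // => m _ /=; rewrite mcoeffZ mcoeffX.
by case: eqP => [->|_]; rewrite ?w0 ?mul0r ?mulr0.
Qed.

End TorusWeights.

(** * Stable divisors *)

Section TorusAction.
Variables (K : closedFieldType) (n : nat) (X : affineVariety K n) (d : nat).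
Variable T : toricStructure X d.
Implicit Types (D : primeDivisor X) (p f : {mpoly K[n]}) (x y : 'rV[K]_n).

Lemma torus_act_pullback p : exists H : {mpoly K[(d + d) + n]},
  forall t y, torus t -> points X y ->
    p.@[torus_act T t y 0] = H.@[(row_mx t y) 0].
Proof.
have [P PE] := torus_act_polynomial T.
exists (p \mPo [tuple P j | j < n]) => t y Tt Xy.
rewrite comp_mpoly_meval; apply: meval_eq => j; rewrite tnth_mktuple -PE /=;
  by rewrite row_mxKl row_mxKr.
Qed.

Lemma partial_eval m (H : {mpoly K[m + n]}) (t : 'rV[K]_m) :
  exists q : {mpoly K[n]}, forall y, q.@[y 0] = H.@[(row_mx t y) 0].
Proof.
exists (H \mPo [tuple match split k with
                      | inl i => (t 0 i)%:MP
                      | inr j => 'X_j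
                      end | k < m + n]) => y.
rewrite comp_mpoly_meval; apply: meval_eq => k; rewrite tnth_mktuple mxE.
by case: split => j; rewrite ?mevalC ?mevalXU.
Qed.

(** For each fixed [t], the equations of [Z] pull back to polynomials in [y]; [S'] collects them
    over all [t]. *)
Lemma transporter_closed (Z : set 'rV[K]_n) : zariski_closed Z ->
  exists2 Z', zariski_closed Z' & forall y, points X y ->
    (Z' y <-> forall t, torus t -> Z (torus_act T t y)).
Proof.
move=> [S ->]; pose S' : set {mpoly K[n]} := [set q | exists t p,
  [/\ torus t, S p & forall y, points X y -> q.@[y 0] = p.@[torus_act T t y 0]]].
exists [set y | forall q, S' q -> q.@[y 0] = 0]; first by exists S'.
move=> y Xy; split=> [Z'y t Tt p Sp|Zy q [t [p [Tt Sp qp]]]]; last first.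
  by rewrite qp //; exact: Zy.
have [H HE] := torus_act_pullback p; have [q qE] := partial_eval H t.
rewrite HE // -qE; apply: Z'y; exists t, p; split=> // z Xz.
by rewrite qE HE.
Qed.

(** Otherwise equations of [Z1] and [Z2] pull back to two functions on the torus with zero product,
    neither of them zero. *)
Lemma orbit_irreducible Z1 Z2 y : zariski_closed Z1 -> zariski_closed Z2 ->
  points X y -> (forall t, torus t -> (Z1 `|` Z2) (torus_act T t y)) ->
  (forall t, torus t -> Z1 (torus_act T t y)) \/
  (forall t, torus t -> Z2 (torus_act T t y)).
Proof.
move=> c1 c2 Xy sub; apply: contrapT.
move=> /not_orP[/existsNP[t1 /not_implyP[T1 n1]] /existsNP[t2 /not_implyP[T2 n2]]].
have [p1 [Z1p p1t]] := zariski_closed_separate c1 n1.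
have [p2 [Z2p p2t]] := zariski_closed_separate c2 n2.
have [H1 H1E] := torus_act_pullback p1; have [H2 H2E] := torus_act_pullback p2.
have [t Tt|H10|H20] := @torus_polynomial_prime _ _ _ H1 H2 y.
- rewrite -H1E // -H2E //.
  by case: (sub t Tt) => [/Z1p|/Z2p] ->; rewrite ?mul0r ?mulr0.
- by rewrite H1E // H10 // eqxx in p1t.
- by rewrite H2E // H20 // eqxx in p2t.
Qed.

(* The closure of [T . D] is irreducible and contained in the zero locus of
   [f], hence equal to [D] since [D] has codimension one. *)
Lemma divisor_of_stable_invariant f x D :
  points X x -> f.@[x 0] != 0 ->
  (forall t y, torus t -> points X y -> f.@[y 0] = 0 ->
     f.@[torus_act T t y 0] = 0) ->
  D `<=` hypersurface f -> torus_invariant T D.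
Proof.
move=> Xx fx stable Df.
pose I := [set p | forall t y, torus t -> divisor_points D y -> p.@[torus_act T t y 0] = 0].
pose C : set 'rV[K]_n := [set z | forall p, I p -> p.@[z 0] = 0].
have DX : D `<=` X by exact: divisor_sub.
have TDC t y : torus t -> divisor_points D y -> C (torus_act T t y).
  by move=> Tt Dy p; exact.
have cC : zariski_closed C by exists I.
have minC Z : zariski_closed Z ->
    (forall y, divisor_points D y -> forall t, torus t -> Z (torus_act T t y)) -> C `<=` Z.
  move=> [S ->] sub z Cz p Sp; apply: Cz => t y Tt Dy; exact: (sub y Dy t Tt p Sp).
have DC : D `<=` C.
  move=> y Dy; rewrite -(torus_act1 T (DX y Dy)).
  by apply: TDC => //; exact: torus_one_in.
have [[y0 Dy0] irrD] := divisor_irreducible D.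
have irrC : zariski_irreducible C.
  split=> [|Z1 Z2 c1 c2 sub]; first by exists y0; exact: DC.
  have [Z1' c1' Z1'P] := transporter_closed c1.
  have [Z2' c2' Z2'P] := transporter_closed c2.
  (* Every orbit through [D] lies in [Z1] or in [Z2], so the two transporters cover the irreducible
     [D]. *)
  have [y Dy|D1|D2] := irrD _ _ c1' c2'.
  - rewrite /setU /= Z1'P ?Z2'P; [|exact: DX..].
    by apply: orbit_irreducible => // [|t Tt]; [exact: DX|exact/sub/TDC].
  - by left; apply: minC => // y Dy; apply/Z1'P; [exact: DX|exact: D1].
  - by right; apply: minC => // y Dy; apply/Z2'P; [exact: DX|exact: D2].
have CX : C `<=` X.
  apply: minC => [|y Dy t Tt]; first exact: points_closed.
  by apply: torus_act_in => //; exact: DX.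
suff eDC : divisor_points D = C by move=> t y Tt Dy; rewrite eDC; exact: TDC.
(* If [C] were larger than [D], it would be [X] and contain [x], yet [f] vanishes on [C]. *)
apply: contrapT => neDC; have eCX : C = X.
  apply: (divisor_codim1 (p := D)) => //; rewrite properEneq; split=> //; exact/eqP.
have : C x by rewrite eCX.
move=> /(_ f) fx0; rewrite fx0 ?eqxx // in fx => t y Tt Dy.
by apply: stable => //; [exact: DX|exact: Df].
Qed.

(* [f] is a weight component of a function vanishing on [D] but not at [x]. *)
Lemma exists_semi_invariant x D : points X x -> torus_invariant T D -> ~ divisor_points D x ->
  exists f, [/\ D `<=` hypersurface f, f.@[x 0] != 0 &
    forall t y, torus t -> points X y -> f.@[y 0] = 0 ->
      f.@[torus_act T t y 0] = 0].
Proof.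
move=> Xx invD nDx; have DX : D `<=` X by exact: divisor_sub.
have [h [Dh hx]] := zariski_closed_separate (divisor_closed D) nDx.
have [H HE] := torus_act_pullback h.
have T1 : torus (torus_one K d) by exact: torus_one_in.
(* At the unit of the torus this polynomial takes the value of [h] at [x]; its leading monomial then
   serves as the weight. *)
have /mlead_supp : laurent H x != 0.
  apply: contra_neq hx => L0; have := laurentE H x T1; rewrite L0 meval0.
  rewrite -HE // torus_act1 // big1 ?expr1n ?mul1r // => i _.
  by rewrite /torus_coord mxE.
set w := mlead _; rewrite mcoeff_msupp laurent_coef => fx.
exists (weight_part H w); split=> // [y Dy|s y Ts Xy].
  (* By invariance of [D], [h] vanishes on the whole orbit of [y], so all its weight parts vanish at
     [y]. *)
  rewrite /hypersurface /= -laurent_coef laurent_eq0 ?mcoeff0 // => t Tt.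
  by rewrite -HE ?Dh //; [exact: invD|exact: DX].
apply: weight_part_translate (Ts) _ => t Tt.
by rewrite -!HE ?torus_actM //; [exact: torus_mul_in|exact: torus_act_in].
Qed.

End TorusAction.

(** * The class group *)

Section Semigroups.
Variables (V : zmodType) (S : set V).

Lemma semigroup_generated0 : semigroup_generated S 0.
Proof. by move=> A [[A0 _] _]; exact: set_mem A0. Qed.

Lemma semigroup_generatedD u v : semigroup_generated S u ->
  semigroup_generated S v -> semigroup_generated S (u + v).
Proof.
move=> Su Sv A AS; have [[_ AD] _] := AS.
by apply: set_mem; apply: AD; apply: mem_set; [exact: Su|exact: Sv].
Qed.

Lemma semigroup_generatedMn u k :
  semigroup_generated S u -> semigroup_generated S (u *+ k).
Proof.
move=> Su; elim: k => [|k IH]; first exact: semigroup_generated0.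
by rewrite mulrS; exact: semigroup_generatedD.
Qed.

Lemma subgroup_generated0 : subgroup_generated S 0.
Proof. by move=> A [[A0 _] _]; exact: set_mem A0. Qed.

Lemma subgroup_generatedB u v : subgroup_generated S u ->
  subgroup_generated S v -> subgroup_generated S (u - v).
Proof.
move=> Su Sv A AS; have [[_ AB] _] := AS.
by apply: set_mem; apply: AB; apply: mem_set; [exact: Su|exact: Sv].
Qed.

(** Negatives of generators suffice: the set [A] of elements whose negative lies in the semigroup is
    itself a semigroup containing [S]. *)
Lemma subgroup_generated_semigroup :
  (forall u, S u -> semigroup_generated S (- u)) ->
  subgroup_generated S = semigroup_generated S.
Proof.
move=> SN; apply/seteqP; split;
  (apply: smallest_sub; last exact: sub_gen_smallest); last first.
  split; first exact: (@mem_set _ (subgroup_generated S) _ subgroup_generated0).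
  move=> u v /set_mem Gu /set_mem Gv; apply: (@mem_set _ (subgroup_generated S)).
  rewrite -(opprK v) -[- v]sub0r; apply: subgroup_generatedB => //.
  by apply: subgroup_generatedB => //; exact: subgroup_generated0.
split; first exact: (@mem_set _ (semigroup_generated S) _ semigroup_generated0).
move=> u v /set_mem Gu /set_mem Gv; apply: (@mem_set _ (semigroup_generated S)).
apply: semigroup_generatedD => //.
pose A : set V := [set w | semigroup_generated S (- w)].
suff : semigroup_generated S `<=` A by exact.
apply: smallest_sub => //; split=> [|a b /set_mem Ga /set_mem Gb].
  by apply: (@mem_set _ A); rewrite /A /= oppr0; exact: semigroup_generated0.
by apply: (@mem_set _ A); rewrite /A /= opprD; exact: semigroup_generatedD.
Qed.

End Semigroups.

(** * Relations from divisors of regular functions *)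

Section EffectiveDivisors.
Variables (K : closedFieldType) (n : nat) (X : affineVariety K n).

Lemma class_principal (E : weilDivisor X) : principal E ->
  \pi_(Quotient.quot (@principal_subgroup K n X)) E = 0.
Proof.
move=> pE; apply/eqP.
rewrite -(raddf0 (\pi_(Quotient.quot (@principal_subgroup K n X)))).
rewrite -Quotient.idealrBE subr0.
by apply/asboolP; exact: sub_gen_smallest.
Qed.

(** The relation is the class of the principal divisor of [f], with [v] giving the orders; [f] is
    nonzero on [X] because of [x]. *)
Lemma class_relation f x : points X x -> f.@[x 0] != 0 ->
  exists (s : seq (primeDivisor X)) (v : primeDivisor X -> nat),
    [/\ uniq s, forall D : primeDivisor X, D \in s <-> D `<=` hypersurface f,
      forall D, D \in s -> (0 < v D)%N &
      \sum_(D <- s) divisor_class D *+ v D = 0].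
Proof.
move=> Xx fx; pose a := coord_pi X f.
have a0 : a != 0.
  by apply: contra_neq fx => a0; rewrite -(coord_eval_pi f Xx) -/a a0 coord_eval0.
have /choice[v vP] (D : primeDivisor X) := has_order_regular D a0.
have [s0 s0P] : exists s : seq (primeDivisor X),
    forall D : primeDivisor X, D `<=` X `&` hypersurface f -> D \in s.
  apply: finitely_many_divisors.
    exact: zariski_closedI (points_closed X) (hypersurface_closed f).
  by split=> [y []//|/(_ x Xx)[_ fx0]]; rewrite fx0 eqxx in fx.
pose s := undup [seq D : primeDivisor X <- s0 | `[< D `<=` hypersurface f >]].
have sP (D : primeDivisor X) : D \in s <-> D `<=` hypersurface f.
  rewrite mem_undup mem_filter; split=> [/andP[/asboolP]//|Df].
  rewrite s0P ?andbT; first exact/asboolP.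
  by move=> y Dy; split; [exact: divisor_sub Dy|exact: Df].
have s_uniq : uniq s by exact: undup_uniq.
have v_gt0 D : (D \in s) = (0 < v D)%N.
  apply/idP/idP => [/sP/divisor_ideal_pi|]; first by move/(vP D).2.
  by move/(vP D).2/divisor_ideal_pi/sP.
exists s, v; split=> // [D|]; first by rewrite v_gt0.
pose E : weilDivisor X := \sum_(D <- s) (<< D >> : weilDivisor X) *+ v D.
have : principal E.
  exists (to_functionField a); first by rewrite tofrac_eq0.
  move=> D; suff -> : coeff D E = (v D)%:Z by exact: (vP D).1.
  rewrite raddf_sum /=; have [Ds|nDs] := boolP (D \in s).
    rewrite (bigD1_seq D) //= big1 ?addr0 => [|D' /negPf neD].
      by rewrite coeffMn coeffU eqxx mulr1 natz.
    by rewrite coeffMn coeffU neD mulr0 mul0rn.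
  have -> : v D = 0%N by apply/eqP; rewrite -leqn0 leqNgt -v_gt0.
  rewrite big_seq big1 // => D' D's; rewrite coeffMn coeffU.
  by case: eqP => [eD|_]; [rewrite -eD D's in nDs|rewrite mulr0 mul0rn].
move=> /class_principal E0; rewrite -[RHS]E0 raddf_sum; apply: eq_bigr => D _.
by rewrite raddfMn.
Qed.

End EffectiveDivisors.

Theorem proposition7 (K : closedFieldType) (charK0 : [pchar K]%R =i pred0)
    (n d : nat) (X : affineVariety K n) (T : toricStructure X d)
    (x : 'rV[K]_n) (Xx : points X x) :
  orbit_group T (torus_orbit T x) = orbit_semigroup T (torus_orbit T x).
Proof.
apply: subgroup_generated_semigroup => _ [D0 [invD0 nOD0] <-].
have nD0x : ~ divisor_points D0 x.
  by move=> D0x; apply: nOD0 => _ [t Tt <-]; exact: invD0.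
have [f [D0f fx stable]] := exists_semi_invariant Xx invD0 nD0x.
have [s [v [s_uniq sP v_gt0 rel]]] := class_relation Xx fx.
have D0s : D0 \in s by apply/sP.
(* Stability of the zero locus of [f] makes [D] invariant, and [D] misses [x] because [f] does not
   vanish there. *)
have off D : D \in s -> orbit_semigroup T (torus_orbit T x) (divisor_class D).
  move=> /sP Df; apply: sub_gen_smallest; exists D => //; split.
    exact: divisor_of_stable_invariant Xx fx stable Df.
  move=> /(_ x) Dx; have /Df/eqP : divisor_points D x.
    by apply: Dx; exists (torus_one K d); [exact: torus_one_in|exact: torus_act1].
  by rewrite (negPf fx).
(* Positivity of [v D0] lets one copy of the class of [D0] be split off; its negative is the
   nonnegative combination that remains. *)
move: rel; rewrite (bigD1_seq D0) //= -(prednK (v_gt0 _ D0s)) mulrS -addrA.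
move=> /eqP; rewrite addr_eq0 => /eqP ->; rewrite opprK.
apply: semigroup_generatedD; first by apply: semigroup_generatedMn; exact: off.
rewrite big_seq_cond; apply: (big_ind (orbit_semigroup T (torus_orbit T x))).
- exact: semigroup_generated0.
- by move=> ? ?; exact: semigroup_generatedD.
- by move=> D /andP[/off Ds _]; exact: semigroup_generatedMn.
Qed.
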